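(* Let $\vec\omega\in\mathbb R^3$ be a constant nonzero vector, $\vec r_0\in\mathbb R^3$, and let $\vec f:[0,T)\to\mathbb R^3$ be continuous ($0<T\le\infty$). The solution of the Cauchy problem $$\dot{\vec r}+\vec\omega\times\vec r=\vec f,\qquad \vec r(0)=\vec r_0,$$ is $$\vec r=\vec f_0+\vec\omega\times\vec f_1+\vec\omega\times(\vec\omega\times\vec f_2),\qquad \vec f_k=\varphi_k\vec r_0+\varphi_k*\vec f,\quad k=0,1,2,$$ where $$\varphi_0(t)=1,\qquad \varphi_1(t)=-\frac{\sin(\|\vec\omega\|t)}{\|\vec\omega\|},\qquad \varphi_2(t)=\frac{1-\cos(\|\vec\omega\|t)}{\|\vec\omega\|^2}.$$
   Context: Vectors are in oriented Euclidean three-space, $\times$ is the cross product, the dot denotes $d/dt$, and $(\varphi*\vec f)(t)=\int_0^t\varphi(\tau)\vec f(t-\tau)\,d\tau$ (componentwise). *)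

(* Defs.v *)
From Stdlib Require Import Reals.
From Coquelicot Require Import Coquelicot.
Open Scope R_scope.

Notation vec3 := (R * R * R)%type.

(* [norm] on [vec3] is the Euclidean norm, because Coquelicot's norm on a
   product is the l^2 combination of the norms of the factors. *)
Lemma norm_vec3 (x y z : R) :
  norm ((x, y, z) : vec3) = sqrt (x ^ 2 + y ^ 2 + z ^ 2).
Proof.
unfold norm; simpl; unfold prod_norm, norm; simpl; unfold prod_norm, norm; simpl.
unfold abs; simpl; f_equal.
rewrite !Rmult_1_r, sqrt_sqrt.
- now rewrite <- !Rabs_mult, !Rabs_right by (apply Rle_ge, Rle_0_sqr).
- apply Rplus_le_le_0_compat; apply Rle_0_sqr.
Qed.

Definition cross (u v : vec3) : vec3 :=
  let '(u1, u2, u3) := u in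
  let '(v1, v2, v3) := v in
  (u2 * v3 - u3 * v2, u3 * v1 - u1 * v3, u1 * v2 - u2 * v1).

(* The half-open interval [0, T), with T = +oo allowed. *)
Definition time_domain (T : Rbar) (t : R) : Prop := 0 <= t /\ Rbar_lt t T.

(* Derivative at [t] relative to the domain [D]: [is_derive] with the filter
   [locally t] restricted to [D].  On [0, T) it is the two-sided derivative at
   interior points and the right derivative at 0. *)
Definition is_derive_on (D : R -> Prop) (r : R -> vec3) (t : R) (l : vec3) :
    Prop :=
  filterdiff r (within D (locally t)) (fun h : R => scal h l).

(* Trajectories are total functions of which only the values on [0, T) matter;
   accordingly solutions are constrained on [0, T) only. *)
Definition is_cauchy_solution
    (w r0 : vec3) (T : Rbar) (f r : R -> vec3) : Prop :=
  r 0 = r0 /\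
  forall t : R, time_domain T t ->
    exists dr : vec3,
      is_derive_on (time_domain T) r t dr /\ plus dr (cross w (r t)) = f t.

Definition convolution (phi : R -> R) (f : R -> vec3) (t : R) : vec3 :=
  (RInt (fun tau => phi tau * fst (fst (f (t - tau)))) 0 t,
   RInt (fun tau => phi tau * snd (fst (f (t - tau)))) 0 t,
   RInt (fun tau => phi tau * snd (f (t - tau))) 0 t).

Definition phi0 (w : vec3) (t : R) : R := 1.
Definition phi1 (w : vec3) (t : R) : R := - (sin (norm w * t) / norm w).
Definition phi2 (w : vec3) (t : R) : R := (1 - cos (norm w * t)) / norm w ^ 2.

Definition response (phi : R -> R) (r0 : vec3) (f : R -> vec3) (t : R) : vec3 :=
  plus (scal (phi t) r0) (convolution phi f t).

(* Main.v *)
Require Import Defs.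
From Stdlib Require Import Reals Lra.
From Coquelicot Require Import Coquelicot.
Open Scope R_scope.

(** Differentiating a convolution by Leibniz' rule gives
    (phi * g)' = phi(0) g + phi' * g.  For the three kernels, phi_0(0) = 1,
    phi_1(0) = phi_2(0) = 0 and, with n = |w|,

      phi_0' = 0,   phi_1' = n^2 phi_2 - phi_0,   phi_2' = - phi_1.

    Hence the responses f_k = phi_k r_0 + phi_k * f satisfy f_0' = f,
    f_1' = n^2 f_2 - f_0, f_2' = - f_1 ([is_derive_response]), and
    w x (w x (w x v)) = - n^2 (w x v) turns this triangular system into
    r' = f - w x r for r = f_0 + w x f_1 + w x (w x f_2)
    ([is_derive_formula]).

    These computations want a forcing continuous on the whole line, whereas f
    is continuous on [0, T) only and may have no limit at T.  Since the value
    of the formula at t depends on f on [0, t] only, near a given t the function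
    f may be replaced by its composition with the projection of the line on an
    interval [0, b], where t < b < T ([formula_is_cauchy_solution]).

    Conversely, the difference u of two solutions satisfies u' = - w x u and
    u(0) = 0; because w x u is orthogonal to u, the quantity |u|^2 is constant,
    hence zero ([cauchy_solution_unique]).  So the solution is unique, and every
    solution is given by the formula. *)

(** * Derivative of a convolution *)

(** [vec3] as a normed module, for the places where unification does not
    recover the structure from the carrier. *)
Notation euclidean3 := (prod_NormedModule R_AbsRing
  (prod_NormedModule R_AbsRing R_NormedModule R_NormedModule) R_NormedModule).

Lemma continuous_reflect (g : R -> R) (t x : R) :
  (forall s, continuous g s) -> continuous (fun s => g (t - s)) x.
Proof.
intros Hg; apply (continuous_comp (fun s => t - s) g); [| apply Hg].
apply (continuous_minus (fun _ => t) (fun s => s));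
  [apply continuous_const | apply continuous_id].
Qed.

(** Moving the shift from [g] to [psi] makes the integrand differentiable in
    [t] when only the kernel is smooth. *)
Lemma convolution_flip (psi g : R -> R) (t : R) :
  (forall s, continuous psi s) -> (forall s, continuous g s) ->
  RInt (fun tau => psi tau * g (t - tau)) 0 t
  = RInt (fun s => psi (t - s) * g s) 0 t.
Proof.
intros psi_cont g_cont.
assert (Hc : forall x, continuous (fun s => psi (t - s) * g s) x).
{ intros x. apply (continuous_mult (fun s => psi (t - s)) g).
  - now apply continuous_reflect.
  - apply g_cont. }
assert (H := RInt_comp (fun s => psi (t - s) * g s) (fun tau => t - tau)
               (fun _ => -1) 0 t (fun x _ => Hc (t - x))).
rewrite Rminus_0_r, Rminus_diag in H.
rewrite <- (opp_RInt_swap (fun s => psi (t - s) * g s) t 0), <- H.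
- rewrite <- RInt_opp.
  + apply RInt_ext; intros x _; unfold opp, scal; simpl; unfold mult; simpl.
    replace (t - (t - x)) with x by ring; ring.
  + apply (ex_RInt_continuous (V := R_CompleteNormedModule)); intros x _.
    apply (continuous_scal_r (-1) (fun y => psi (t - (t - y)) * g (t - y))).
    now apply (continuous_reflect (fun s => psi (t - s) * g s)).
- intros x _; split; [| apply continuous_const].
  auto_derive; auto; ring.
- apply (ex_RInt_continuous (V := R_CompleteNormedModule)); intros x _; apply Hc.
Qed.

Lemma is_derive_convolution (phi dphi g : R -> R) (t : R) :
  (forall s, is_derive phi s (dphi s)) -> (forall s, continuous dphi s) ->
  (forall s, continuous g s) ->
  is_derive (fun t => RInt (fun tau => phi tau * g (t - tau)) 0 t) t
    (phi 0 * g t + RInt (fun tau => dphi tau * g (t - tau)) 0 t).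
Proof.
intros phi_deriv dphi_cont g_cont.
assert (phi_cont : forall s, continuous phi s).
{ intros s; apply (ex_derive_continuous (V := R_NormedModule)).
  now exists (dphi s). }
assert (Hd : forall s u, is_derive (fun z => phi (z - s) * g s) u
                           (dphi (u - s) * g s)).
{ intros s u; auto_derive; [now exists (dphi (u - s)) |].
  replace (u + - s) with (u - s) by ring.
  replace (Derive (fun x : R => phi x) (u - s)) with (dphi (u - s))
    by (symmetry; apply is_derive_unique, phi_deriv); ring. }
assert (Hcont : forall u x, continuous (fun s => phi (u - s) * g s) x).
{ intros u x. apply (continuous_mult (fun s => phi (u - s)) g); [| apply g_cont].
  now apply continuous_reflect. }
assert (H2d : forall u s, continuity_2d_pt
                (fun u s => Derive (fun z => phi (z - s) * g s) u) u s).
{ intros u s.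
  apply (continuity_2d_pt_ext (fun u s => dphi (u - s) * g s)).
  - intros x y; symmetry; apply is_derive_unique, Hd.
  - apply continuity_2d_pt_mult.
    + apply (continuity_1d_2d_pt_comp dphi (fun u s => u - s)).
      * apply continuity_pt_filterlim, dphi_cont.
      * apply continuity_2d_pt_minus;
          [apply continuity_2d_pt_id1 | apply continuity_2d_pt_id2].
    + apply (continuity_1d_2d_pt_comp g (fun _ s => s)).
      * apply continuity_pt_filterlim, g_cont.
      * apply continuity_2d_pt_id2. }
assert (Hex : forall u a b, ex_RInt (fun s => phi (u - s) * g s) a b).
{ intros u a b; apply (ex_RInt_continuous (V := R_CompleteNormedModule)).
  intros x _; apply Hcont. }
apply (is_derive_ext (fun t => RInt (fun s => phi (t - s) * g s) 0 t)).
{ intros u; symmetry; now apply convolution_flip. }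
rewrite (convolution_flip dphi g) by assumption.
rewrite <- (RInt_ext (fun s => Derive (fun z => phi (z - s) * g s) t)).
2: { intros s _; apply is_derive_unique, Hd. }
replace (phi 0) with (phi (t - t)) by (f_equal; ring).
rewrite Rplus_comm, <- (Rmult_1_r (phi (t - t) * g t)).
apply (is_derive_RInt_param_bound_comp_aux3
         (fun u s => phi (u - s) * g s) 0 (fun t => t)).
- now apply filter_forall.
- exists posreal_one; now apply filter_forall.
- apply (is_derive_id (K := R_AbsRing)).
- exists posreal_one; apply filter_forall; intros u s _.
  exists (dphi (u - s) * g s); apply Hd.
- now intros s _.
- exists posreal_one; now intros.
- apply continuity_pt_filterlim, Hcont.
Qed.

(** * Componentwise differentiation in three-space *)

(** A general filter covers both the two-sided derivative and the derivative
    relative to a domain. *)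
Lemma filterdiff_vec3 (F : (R -> Prop) -> Prop) (FF : Filter F)
    (r1 r2 r3 : R -> R) (l : vec3) :
  filterdiff r1 F (fun h => scal h (fst (fst l))) ->
  filterdiff r2 F (fun h => scal h (snd (fst l))) ->
  filterdiff r3 F (fun h => scal h (snd l)) ->
  filterdiff (fun t => (r1 t, r2 t, r3 t) : vec3) F (fun h : R => scal h l).
Proof.
destruct l as [[l1 l2] l3]; intros H1 H2 H3.
assert (pair_diff : forall (U V : NormedModule R_AbsRing) (G : (U * V -> Prop) -> Prop),
  filterdiff (fun t : prod_NormedModule _ U V => (fst t, snd t)) G
    (fun t => (fst t, snd t))).
{ intros U V G; apply filterdiff_linear.
  apply (is_linear_ext (fun t => t)); [now intros [x y] | apply is_linear_id]. }
refine (filterdiff_comp_2 _ r3 pair _ (fun h => scal h l3) pair _ H3 _).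
- refine (filterdiff_comp_2 r1 r2 pair (fun h => scal h l1) (fun h => scal h l2) pair H1 H2 _).
  apply pair_diff.
- apply pair_diff.
Qed.

Lemma filterdiff_vec3_proj (F : (R -> Prop) -> Prop) (FF : Filter F)
    (r : R -> vec3) (l : vec3) :
  filterdiff r F (fun h : R => scal h l) ->
  filterdiff (fun t => fst (fst (r t))) F (fun h => scal h (fst (fst l))) /\
  filterdiff (fun t => snd (fst (r t))) F (fun h => scal h (snd (fst l))) /\
  filterdiff (fun t => snd (r t)) F (fun h => scal h (snd l)).
Proof.
intros H.
assert (H12 := filterdiff_comp r fst _ fst H (filterdiff_linear _ is_linear_fst)).
split; [| split].
- exact (filterdiff_comp _ fst _ fst H12 (filterdiff_linear _ is_linear_fst)).
- exact (filterdiff_comp _ snd _ snd H12 (filterdiff_linear _ is_linear_snd)).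
- exact (filterdiff_comp _ snd _ snd H (filterdiff_linear _ is_linear_snd)).
Qed.

(** * The kernels and their responses *)

Lemma phi_derivatives (w : vec3) (t : R) :
  norm w <> 0 ->
  is_derive (phi0 w) t 0 /\
  is_derive (phi1 w) t (norm w ^ 2 * phi2 w t - phi0 w t) /\
  is_derive (phi2 w) t (- phi1 w t).
Proof.
intros Hw; unfold phi0, phi1, phi2; split; [| split].
- apply (is_derive_const (V := R_NormedModule) 1 t).
- auto_derive; [auto | field; exact Hw].
- auto_derive; [auto | field; exact Hw].
Qed.

Lemma is_derive_response_scalar (w : vec3) (g : R -> R) (x t : R) :
  norm w <> 0 -> (forall s, continuous g s) ->
  let F := fun phi t => phi t * x + RInt (fun tau => phi tau * g (t - tau)) 0 t in
  is_derive (F (phi0 w)) t (g t) /\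
  is_derive (F (phi1 w)) t (norm w ^ 2 * F (phi2 w) t - F (phi0 w) t) /\
  is_derive (F (phi2 w)) t (- F (phi1 w) t).
Proof.
intros Hw Hg F.
assert (D0 := fun s => proj1 (phi_derivatives w s Hw)).
assert (D1 := fun s => proj1 (proj2 (phi_derivatives w s Hw))).
assert (D2 := fun s => proj2 (proj2 (phi_derivatives w s Hw))).
assert (cont : forall phi dphi : R -> R, (forall s, is_derive phi s (dphi s)) ->
                 forall s, continuous phi s).
{ intros phi dphi D s; apply (ex_derive_continuous (V := R_NormedModule)).
  now exists (dphi s). }
assert (C0 := cont _ _ D0); assert (C1 := cont _ _ D1); assert (C2 := cont _ _ D2).
assert (ex : forall phi : R -> R, (forall s, continuous phi s) ->
               ex_RInt (fun tau => phi tau * g (t - tau)) 0 t).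
{ intros phi C; apply (ex_RInt_continuous (V := R_CompleteNormedModule)).
  intros s _; apply (continuous_mult phi (fun tau => g (t - tau))); [apply C |].
  now apply continuous_reflect. }
(* The derivative of a response is the response of the derived kernel,
   plus the instantaneous term phi(0) g(t). *)
assert (DF : forall phi dphi : R -> R, (forall s, is_derive phi s (dphi s)) ->
          (forall s, continuous dphi s) ->
          is_derive (F phi) t (phi 0 * g t + F dphi t)).
{ intros phi dphi D C; unfold F.
  replace (phi 0 * g t + _)
    with (plus (x * dphi t)
            (phi 0 * g t + RInt (fun tau => dphi tau * g (t - tau)) 0 t))
    by (unfold plus; simpl; ring).
  apply (is_derive_plus (V := R_NormedModule)).
  - apply (is_derive_ext (fun t => x * phi t)); [intros; apply Rmult_comm |].
    apply is_derive_scal, D.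
  - now apply is_derive_convolution. }
split; [| split].
- replace (g t) with (phi0 w 0 * g t + F (fun _ => 0) t).
  + apply (DF _ (fun _ => 0) D0); intros s; apply continuous_const.
  + unfold F, phi0.
    rewrite (RInt_ext _ (fun _ => 0)) by (intros; apply Rmult_0_l).
    rewrite RInt_const; unfold scal; simpl; unfold mult; simpl; ring.
- replace (norm w ^ 2 * _ - _)
    with (phi1 w 0 * g t + F (fun s => norm w ^ 2 * phi2 w s - phi0 w s) t).
  + apply DF; [exact D1 | intros s].
    apply (continuous_minus (fun s => norm w ^ 2 * phi2 w s) (phi0 w)); [| apply C0].
    apply (continuous_scal_r (norm w ^ 2) (phi2 w)), C2.
  + unfold F.
    rewrite (is_RInt_unique (V := R_CompleteNormedModule) _ 0 t
      (norm w ^ 2 * RInt (fun tau => phi2 w tau * g (t - tau)) 0 t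
       - RInt (fun tau => phi0 w tau * g (t - tau)) 0 t)).
    2: { apply (is_RInt_ext (V := R_NormedModule)
           (fun tau => minus (scal (norm w ^ 2) (phi2 w tau * g (t - tau)))
                         (phi0 w tau * g (t - tau)))).
         { intros; unfold minus, plus, opp, scal; simpl; unfold mult; simpl; ring. }
         apply (is_RInt_minus (V := R_NormedModule));
           [apply (is_RInt_scal (V := R_NormedModule)) |];
           apply (RInt_correct (V := R_CompleteNormedModule)), ex; assumption. }
    unfold phi1 at 1; rewrite Rmult_0_r, sin_0; field; exact Hw.
- replace (- F (phi1 w) t) with (phi2 w 0 * g t + F (fun s => - phi1 w s) t).
  + apply DF; [exact D2 | intros s].
    apply (continuous_opp (phi1 w)), C1.
  + unfold F.
    rewrite (is_RInt_unique (V := R_CompleteNormedModule) _ 0 t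
      (- RInt (fun tau => phi1 w tau * g (t - tau)) 0 t)).
    2: { apply (is_RInt_ext (V := R_NormedModule)
           (fun tau => opp (phi1 w tau * g (t - tau)))).
         { intros; unfold opp; simpl; ring. }
         apply (is_RInt_opp (V := R_NormedModule)).
         apply (RInt_correct (V := R_CompleteNormedModule)), ex; assumption. }
    unfold phi2 at 1; rewrite Rmult_0_r, cos_0; field; exact Hw.
Qed.

(** The derivatives of the responses obey the same relations as those of the
    kernels, except that [phi0 w 0 = 1] contributes the forcing [g t]. *)
Lemma is_derive_response (w r0 : vec3) (g : R -> vec3) (t : R) :
  norm w <> 0 -> (forall s, continuous g s) ->
  is_derive (K := R_AbsRing) (response (phi0 w) r0 g) t (g t) /\
  is_derive (K := R_AbsRing) (response (phi1 w) r0 g) t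
    (minus (scal (norm w ^ 2) (response (phi2 w) r0 g t)) (response (phi0 w) r0 g t)) /\
  is_derive (K := R_AbsRing) (response (phi2 w) r0 g) t
    (opp (response (phi1 w) r0 g t)).
Proof.
intros Hn Hg.
destruct r0 as [[x y] z].
assert (G1 : forall s, continuous (fun t => fst (fst (g t))) s).
{ intros s; apply (continuous_comp (fun t => fst (g t)) fst), continuous_fst.
  apply (continuous_comp g fst), continuous_fst; apply Hg. }
assert (G2 : forall s, continuous (fun t => snd (fst (g t))) s).
{ intros s; apply (continuous_comp (fun t => fst (g t)) snd), continuous_snd.
  apply (continuous_comp g fst), continuous_fst; apply Hg. }
assert (G3 : forall s, continuous (fun t => snd (g t)) s).
{ intros s; apply (continuous_comp g snd), continuous_snd; apply Hg. }
destruct (is_derive_response_scalar _ _ x t Hn G1) as [X0 [X1 X2]].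
destruct (is_derive_response_scalar _ _ y t Hn G2) as [Y0 [Y1 Y2]].
destruct (is_derive_response_scalar _ _ z t Hn G3) as [Z0 [Z1 Z2]].
split; [| split].
- exact (filterdiff_vec3 _ _ _ _ _ (g t) X0 Y0 Z0).
- exact (filterdiff_vec3 _ _ _ _ _
    (minus (scal (norm w ^ 2) (response (phi2 w) (x, y, z) g t))
       (response (phi0 w) (x, y, z) g t)) X1 Y1 Z1).
- exact (filterdiff_vec3 _ _ _ _ _
    (opp (response (phi1 w) (x, y, z) g t)) X2 Y2 Z2).
Qed.

Lemma is_derive_cross (w l : vec3) (r : R -> vec3) (t : R) :
  is_derive (K := R_AbsRing) r t l ->
  is_derive (K := R_AbsRing) (fun s => cross w (r s)) t (cross w l).
Proof.
destruct w as [[a b] c]; intros H.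
destruct (filterdiff_vec3_proj _ _ _ _ H) as [H1 [H2 H3]].
assert (comb : forall (p q : R) (u v : R -> R) (du dv : R),
   filterdiff u (locally t) (fun h => scal h du) ->
   filterdiff v (locally t) (fun h => scal h dv) ->
   is_derive (fun s => p * u s - q * v s) t (p * du - q * dv)).
{ intros p q u v du dv Hu Hv.
  apply (is_derive_minus (fun s => p * u s) (fun s => q * v s));
    now apply is_derive_scal. }
apply (is_derive_ext (V := euclidean3)
  (fun s => (b * snd (r s) - c * snd (fst (r s)),
             c * fst (fst (r s)) - a * snd (r s),
             a * snd (fst (r s)) - b * fst (fst (r s))) : vec3)).
{ intros s; destruct (r s) as [[x y] z]; reflexivity. }
destruct l as [[l1 l2] l3].
apply filterdiff_vec3; [exact _ | ..].
- exact (comb _ _ _ _ _ _ H3 H2).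
- exact (comb _ _ _ _ _ _ H1 H3).
- exact (comb _ _ _ _ _ _ H2 H1).
Qed.

(** * The explicit formula *)

Definition formula (w r0 : vec3) (f : R -> vec3) (t : R) : vec3 :=
  plus (plus (response (phi0 w) r0 f t)
             (cross w (response (phi1 w) r0 f t)))
       (cross w (cross w (response (phi2 w) r0 f t))).

Lemma norm_sqr_vec3 (x y z : R) :
  norm ((x, y, z) : vec3) ^ 2 = x ^ 2 + y ^ 2 + z ^ 2.
Proof. rewrite norm_vec3, <- Rsqr_pow2, Rsqr_sqrt; [reflexivity | nra]. Qed.

Lemma norm_vec3_neq_0 (w : vec3) : w <> (0, 0, 0) -> norm w <> 0.
Proof.
intros Hw E; apply Hw; exact (norm_eq_zero w E).
Qed.

Lemma is_derive_formula (w r0 : vec3) (g : R -> vec3) (t : R) :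
  w <> (0, 0, 0) -> (forall s, continuous g s) ->
  is_derive (K := R_AbsRing) (formula w r0 g) t
    (minus (g t) (cross w (formula w r0 g t))).
Proof.
intros Hw Hg.
destruct (is_derive_response w r0 g t (norm_vec3_neq_0 w Hw) Hg) as [D0 [D1 D2]].
replace (minus (g t) _)
  with (plus (plus (g t)
     (cross w (minus (scal (norm w ^ 2) (response (phi2 w) r0 g t)) (response (phi0 w) r0 g t))))
     (cross w (cross w (opp (response (phi1 w) r0 g t))))).
- apply (is_derive_plus (V := euclidean3)
    (fun s => plus (response (phi0 w) r0 g s) (cross w (response (phi1 w) r0 g s)))
    (fun s => cross w (cross w (response (phi2 w) r0 g s))));
  [apply (is_derive_plus (V := euclidean3) (response (phi0 w) r0 g)
    (fun s => cross w (response (phi1 w) r0 g s))) |].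
  + exact D0.
  + apply is_derive_cross, D1.
  + apply (is_derive_cross w _ (fun s => cross w (response (phi2 w) r0 g s))), is_derive_cross, D2.
- unfold formula.
  generalize (response (phi0 w) r0 g t) (response (phi1 w) r0 g t) (response (phi2 w) r0 g t) (g t).
  destruct w as [[a b] c]; rewrite norm_sqr_vec3.
  (* Past linearity, the coordinates check the identity w x (w x (w x v)) = - |w|^2 (w x v). *)
  intros [[x0 y0] z0] [[x1 y1] z1] [[x2 y2] z2] [[gx gy] gz].
  unfold minus, plus, opp, scal; simpl.
  unfold prod_plus, prod_opp, prod_scal, minus, plus, opp, scal; simpl.
  unfold prod_plus, prod_opp, prod_scal, minus, plus, opp, scal, mult; simpl.
  f_equal; [f_equal |]; ring.
Qed.

Lemma formula_0 (w r0 : vec3) (f : R -> vec3) : formula w r0 f 0 = r0.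
Proof.
destruct w as [[a b] c], r0 as [[x y] z].
unfold formula, response, convolution; rewrite !RInt_point.
unfold phi0, phi1, phi2; rewrite Rmult_0_r, sin_0, cos_0, Rminus_diag.
unfold Rdiv; rewrite !Rmult_0_l, Ropp_0.
unfold zero, plus, scal; simpl.
unfold prod_plus, prod_scal, zero, plus, scal; simpl.
unfold prod_plus, prod_scal, zero, plus, scal, mult; simpl.
f_equal; [f_equal |]; unfold mult; simpl; ring.
Qed.

Lemma formula_ext (w r0 : vec3) (f g : R -> vec3) (t : R) :
  (forall s, 0 <= s <= t -> f s = g s) -> 0 <= t ->
  formula w r0 f t = formula w r0 g t.
Proof.
intros E Ht.
assert (C : forall phi, convolution phi f t = convolution phi g t).
{ intros phi; unfold convolution.
  f_equal; [f_equal |]; apply RInt_ext; intros s Hs;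
    rewrite Rmin_left, Rmax_right in Hs by assumption; rewrite E by lra; reflexivity. }
unfold formula, response; now rewrite !C.
Qed.

(** * Derivatives relative to a half-open interval *)

Lemma time_domain_open (T : Rbar) (t : R) :
  time_domain T t -> exists b, t < b /\ forall s, 0 <= s <= b -> time_domain T s.
Proof.
intros [Ht HT]; destruct T as [T | |]; simpl in HT.
- exists ((t + T) / 2); split; [lra |]; intros s Hs; split; simpl; lra.
- exists (t + 1); split; [lra |]; intros s Hs; split; simpl; [lra | exact I].
- contradiction.
Qed.

Lemma within_proper (D : R -> Prop) (t : R) :
  D t -> ProperFilter (within D (locally t)).
Proof.
intros Ht; split; [| exact _].
intros P HP; exists t; exact (locally_singleton _ _ HP Ht).
Qed.

Lemma within_lim (D : R -> Prop) (t : R) : is_filter_lim (within D (locally t)) t.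
Proof. intros P HP; exact (filter_le_within D P HP). Qed.

Lemma is_derive_on_within (D : R -> Prop) (r q : R -> vec3) (t : R) (l : vec3) :
  D t -> within D (locally t) (fun s => r s = q s) ->
  is_derive_on D r t l -> is_derive_on D q t l.
Proof.
intros Ht E H.
assert (P := within_proper D t Ht).
refine (filterdiff_ext_loc r q _ E _ H).
intros x Hx.
replace x with t; [exact (locally_singleton _ _ E Ht) |].
exact (is_filter_lim_unique (F := within D (locally t)) (V := R_NormedModule) _ _ (within_lim D t) Hx).
Qed.

Lemma is_derive_on_interior (T : Rbar) (r : R -> vec3) (s : R) (l : vec3) :
  time_domain T s -> 0 < s ->
  is_derive_on (time_domain T) r s l -> is_derive (K := R_AbsRing) r s l.
Proof.
intros Ds Hs [L Dom]; split; [exact L |].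
destruct (time_domain_open T s Ds) as [b [Hb HbT]].
assert (Hle : filter_le (locally s) (within (time_domain T) (locally s))).
{ intros P HP; unfold within in HP.
  generalize (filter_and _ _ HP
    (filter_and _ _ (open_lt b s Hb) (open_gt 0 s Hs))).
  apply filter_imp; intros x [K [K1 K2]]; apply K, HbT; split; lra. }
intros x Hx.
replace x with s
  by exact (is_filter_lim_locally_unique (V := R_NormedModule) _ _ Hx).
exact (is_domin_le _ _ (Dom s (within_lim _ s)) Hle).
Qed.

(** Precomposing with the projection onto [[a, b]] extends the restriction of
    [f] to that segment to a function continuous on the whole line. *)
Lemma continuous_clamp {U : UniformSpace} (D : R -> Prop) (a b : R) (f : R -> U) :
  a <= b -> (forall s, a <= s <= b -> D s) -> continuous_on D f ->
  forall t, continuous (fun s => f (Rmax a (Rmin s b))) t.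
Proof.
intros Hab HD Hf t.
assert (B : forall s, D (Rmax a (Rmin s b))).
{ intros s; apply HD; split; [apply Rmax_l |].
  apply Rmax_lub; [exact Hab | apply Rmin_r]. }
refine (filterlim_comp _ _ _ (fun s => Rmax a (Rmin s b)) f _ _ _ _ (Hf _ (B t))).
(* The projection is 1-Lipschitz, so the same radius works. *)
intros P [eps HP]; exists eps; intros s Hs.
apply HP; [| apply B].
apply Rle_lt_trans with (2 := Hs).
unfold abs, minus, plus, opp; simpl.
unfold Rmax, Rmin; repeat destruct Rle_dec; unfold Rabs; repeat destruct Rcase_abs; lra.
Qed.

(** * Existence *)

Lemma is_cauchy_solution_ext (w r0 : vec3) (T : Rbar) (f r q : R -> vec3) :
  Rbar_lt 0 T -> (forall t, time_domain T t -> r t = q t) ->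
  is_cauchy_solution w r0 T f r -> is_cauchy_solution w r0 T f q.
Proof.
intros HT E [H0 H]; split.
- rewrite <- E; [exact H0 | split; [lra | exact HT]].
- intros t Ht; destruct (H t Ht) as [dr [D Eq]]; exists dr; split.
  + apply (is_derive_on_within _ r); auto.
    exact (filter_forall (F := locally t) _ E).
  + now rewrite <- E.
Qed.

(** At each time [t] the formula is compared with the one for a forcing [g]
    that agrees with [f] on a segment [[0, b]], [t < b], and is continuous
    everywhere. *)
Lemma formula_is_cauchy_solution (w r0 : vec3) (T : Rbar) (f : R -> vec3) :
  w <> (0, 0, 0) -> continuous_on (time_domain T) f ->
  is_cauchy_solution w r0 T f (formula w r0 f).
Proof.
intros Hw Hf; split; [apply formula_0 |]; intros t Ht.
exists (minus (f t) (cross w (formula w r0 f t))); split.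
2: { assert (cancel : forall (G : AbelianGroup) (x y : G), plus (minus x y) y = x).
     { intros G x y; unfold minus.
       now rewrite <- plus_assoc, plus_opp_l, plus_zero_r. }
     apply (cancel euclidean3). }
destruct (time_domain_open T t Ht) as [b [Htb Hb]].
destruct Ht as [Ht HT].
pose (g := fun s => f (Rmax 0 (Rmin s b))).
assert (Hg : forall s, continuous g s).
{ apply (continuous_clamp (time_domain T)); [lra | exact Hb | exact Hf]. }
assert (Efg : forall s, 0 <= s <= b -> f s = g s).
{ intros s Hs; unfold g; rewrite Rmin_left, Rmax_right by lra; reflexivity. }
rewrite (Efg t), (formula_ext w r0 f g t) by (intros; try apply Efg; lra).
apply (is_derive_on_within _ (formula w r0 g)); [now split | |].
- apply (filter_imp (F := locally t) (fun s => s < b)).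
  + intros s Hs [Hs0 _]; symmetry; apply formula_ext; [intros; apply Efg |]; lra.
  + apply (open_lt b t Htb).
- refine (filterdiff_locally (F := within (time_domain T) (locally t)) _ t _ (within_lim _ t) _).
  + apply within_proper; now split.
  + now apply is_derive_formula.
Qed.

(** * Uniqueness *)

(** One-sided continuity at 0 suffices: the mean value theorem, which asks for
    two-sided continuity, is applied to [E] extended by [E 0] on the left. *)
Lemma constant_of_null_derivative (E : R -> R) (t : R) :
  0 < t ->
  filterlim E (within (fun s => 0 <= s) (locally 0)) (locally (E 0)) ->
  (forall s, 0 < s <= t -> is_derive E s 0) -> E t = E 0.
Proof.
intros Ht H0 HE.
destruct (MVT_gen (fun s => E (Rmax 0 s)) 0 t (fun _ => 0)) as [c [_ Hc]].
- intros s Hs; rewrite Rmin_left, Rmax_right in Hs by lra.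
  apply (is_derive_ext_loc E); [| apply HE; lra].
  apply (filter_imp (fun s => 0 < s)); [| apply (open_gt 0 s); lra].
  intros x Hx; rewrite Rmax_right by lra; reflexivity.
- intros s Hs; rewrite Rmin_left, Rmax_right in Hs by lra.
  apply continuity_pt_filterlim.
  destruct (Rle_lt_or_eq_dec 0 s (proj1 Hs)) as [Hs0 | <-].
  + apply (continuous_ext_loc (fun s => E (Rmax 0 s)) E).
    * apply (filter_imp (fun s => 0 < s)); [| apply (open_gt 0 s); lra].
      intros x Hx; rewrite Rmax_right by lra; reflexivity.
    * apply (ex_derive_continuous (V := R_NormedModule)).
      exists 0; apply HE; lra.
  + rewrite Rmax_left by lra.
    refine (filterlim_comp _ _ _ (Rmax 0) E _ _ _ _ H0).
    intros P [eps HP]; exists eps; intros x Hx.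
    apply HP; [| apply Rmax_l].
    apply Rle_lt_trans with (2 := Hx).
    unfold abs, minus, plus, opp; simpl.
    unfold Rmax; destruct Rle_dec; unfold Rabs; repeat destruct Rcase_abs; lra.
- rewrite (Rmax_right 0 t), (Rmax_left 0 0) in Hc by lra; lra.
Qed.

Lemma cauchy_solution_minus (w r0 : vec3) (T : Rbar) (f r q : R -> vec3) :
  is_cauchy_solution w r0 T f r -> is_cauchy_solution w r0 T f q ->
  is_cauchy_solution w (0, 0, 0) T (fun _ => (0, 0, 0))
    (fun s => minus (r s) (q s)).
Proof.
intros [R0 HR] [Q0 HQ]; split.
{ rewrite R0, Q0; apply (minus_eq_zero (G := euclidean3)). }
intros s Hs.
destruct (HR s Hs) as [dr [Dr Er]]; destruct (HQ s Hs) as [dq [Dq Eq]].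
exists (minus dr dq); split.
- apply (filterdiff_ext_lin (V := euclidean3) (fun s => minus (r s) (q s))
           (fun h : R => minus (scal h dr) (scal h dq))).
  + exact (filterdiff_minus_fct (V := euclidean3) r q _ _ Dr Dq).
  + intros h; symmetry; apply (scal_minus_distr_l (V := euclidean3)).
- rewrite <- Eq in Er; revert Er.
  generalize (r s) (q s).
  destruct w as [[a b] c], dr as [[r1 r2] r3], dq as [[q1 q2] q3].
  intros [[x y] z] [[x' y'] z'].
  unfold minus, plus, opp; simpl.
  unfold prod_plus, prod_opp, plus, opp; simpl.
  unfold prod_plus, prod_opp, plus, opp; simpl.
  intros E; injection E; intros; f_equal; [f_equal |]; lra.
Qed.

(** The squared length of [u] is conserved, because [cross w u] is orthogonal
    to [u]. *)
Lemma homogeneous_solution_zero (w : vec3) (T : Rbar) (u : R -> vec3) :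
  is_cauchy_solution w (0, 0, 0) T (fun _ => (0, 0, 0)) u ->
  forall t, time_domain T t -> u t = (0, 0, 0).
Proof.
intros [U0 HU] t Ht.
destruct (Rle_lt_or_eq_dec 0 t (proj1 Ht)) as [Htpos | <-]; [| exact U0].
pose (sqlen := fun s => fst (fst (u s)) * fst (fst (u s))
   + snd (fst (u s)) * snd (fst (u s)) + snd (u s) * snd (u s)).
assert (Het : sqlen t = sqlen 0).
{ apply constant_of_null_derivative; [exact Htpos | |].
  - assert (D0 : time_domain T 0) by (split; [lra |];
      apply Rbar_le_lt_trans with t; [simpl; lra | apply Ht]).
    destruct (time_domain_open T 0 D0) as [b [Hb HbT]].
    destruct (HU 0 D0) as [du [Du _]].
    destruct (filterdiff_vec3_proj _ _ _ _ Du) as [H1 [H2 H3]].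
    assert (C : forall (v : R -> R) (d : R),
       filterdiff v (within (time_domain T) (locally 0)) (fun h => scal h d) ->
       filterlim v (within (time_domain T) (locally 0)) (locally (v 0))).
    { intros v d Hv; apply (filterdiff_continuous_aux (F := within (time_domain T) (locally 0)) v).
      - now exists (fun h => scal h d).
      - apply within_lim. }
    apply C in H1; apply C in H2; apply C in H3.
    apply (filterlim_filter_le_1 (G := within (fun s => 0 <= s) (locally 0)) (F := within (time_domain T) (locally 0))).
    { intros P HP; unfold within in *.
      generalize (filter_and _ _ HP (open_lt b 0 Hb)).
      apply filter_imp; intros s [K Ks] Hs; apply K, HbT; lra. }
    assert (S : forall v : R -> R, filterlim v (within (time_domain T) (locally 0)) (locally (v 0)) ->
       filterlim (fun s => v s * v s) (within (time_domain T) (locally 0)) (locally (v 0 * v 0))).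
    { intros v Hv.
      exact (filterlim_comp_2 v v Rmult Hv Hv (filterlim_mult (v 0) (v 0))). }
    refine (filterlim_comp_2 _ _ Rplus
      (filterlim_comp_2 _ _ Rplus (S _ H1) (S _ H2) _) (S _ H3) _);
      apply (filterlim_plus (V := R_NormedModule)).
  - intros s Hs.
    assert (Ds : time_domain T s).
    { split; [lra |]. apply Rbar_le_lt_trans with t; [simpl; lra | apply Ht]. }
    destruct (HU s Ds) as [du [Dw Eq]].
    apply is_derive_on_interior in Dw; [| exact Ds | apply Hs].
    destruct (filterdiff_vec3_proj _ _ _ _ Dw) as [H1 [H2 H3]].
    unfold sqlen.
    replace 0 with (plus (plus
      (fst (fst du) * fst (fst (u s)) + fst (fst (u s)) * fst (fst du))
      (snd (fst du) * snd (fst (u s)) + snd (fst (u s)) * snd (fst du)))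
      (snd du * snd (u s) + snd (u s) * snd du)).
    + apply (is_derive_plus (V := R_NormedModule)); [apply (is_derive_plus (V := R_NormedModule)) |];
        apply (is_derive_mult (K := R_AbsRing)); try assumption; exact Rmult_comm.
    + revert Eq; destruct w as [[a b'] c], (u s) as [[x y] z], du as [[d1 d2] d3].
      unfold plus; simpl; unfold prod_plus, plus; simpl; unfold prod_plus, plus; simpl.
      (* The equation says du = - w x u, and u . (w x u) = 0. *)
      intros E; injection E; intros E3 E2 E1.
      replace d1 with (- (b' * z - c * y)) by lra.
      replace d2 with (- (c * x - a * z)) by lra.
      replace d3 with (- (a * y - b' * x)) by lra.
      ring. }
revert Het; unfold sqlen; rewrite U0; destruct (u t) as [[x y] z]; simpl; intros Het.
assert (x = 0) by nra; assert (y = 0) by nra; assert (z = 0) by nra; congruence.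
Qed.

Lemma cauchy_solution_unique (w r0 : vec3) (T : Rbar) (f r q : R -> vec3) :
  is_cauchy_solution w r0 T f r -> is_cauchy_solution w r0 T f q ->
  forall t, time_domain T t -> r t = q t.
Proof.
intros HR HQ t Ht.
assert (H := homogeneous_solution_zero w T _
  (cauchy_solution_minus w r0 T f r q HR HQ) t Ht).
revert H; cbv beta; destruct (r t) as [[x y] z], (q t) as [[x' y'] z'].
unfold minus, plus, opp; simpl.
unfold prod_plus, prod_opp, plus, opp; simpl.
unfold prod_plus, prod_opp, plus, opp; simpl.
intros E; injection E; intros; f_equal; [f_equal |]; lra.
Qed.

Theorem mainTheorem12 :
  forall (w r0 : vec3) (T : Rbar) (f : R -> vec3),
    w <> (0, 0, 0) ->
    Rbar_lt 0 T ->
    continuous_on (time_domain T) f ->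
    forall r : R -> vec3,
      is_cauchy_solution w r0 T f r <->
      (forall t : R, time_domain T t ->
         r t = plus (plus (response (phi0 w) r0 f t)
                          (cross w (response (phi1 w) r0 f t)))
                    (cross w (cross w (response (phi2 w) r0 f t)))).
Proof.
intros w r0 T f Hw HT Hf r.
pose proof (formula_is_cauchy_solution w r0 T f Hw Hf) as Hsol.
split.
- intros Hr; exact (cauchy_solution_unique w r0 T f _ _ Hr Hsol).
- intros Hr; apply (is_cauchy_solution_ext w r0 T f (formula w r0 f)); [exact HT | | exact Hsol].
  intros t Ht; symmetry; exact (Hr t Ht).
Qed.
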